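(* Consider the 2-user opportunistic scheduling system with Bernoulli state process of unknown parameter $q\in[0,1]$ described in the context, with utility function $\phi(x_1,x_2)=\log(1+x_1)+\log(1+x_2)$. Fix any (possibly randomized) statistics-unaware control algorithm. (1) There is a probability $q\in[1/4,3/4]$ and a function $g$ on the positive integers with $g(T)=\Omega(\log(T)/T)$ such that, when the state process has parameter $q$, $$\phi\left(\mathbb{E}[\overline X_1[T]],\mathbb{E}[\overline X_2[T]]\right)\le\phi^*-g(T)\qquad\forall\, T\in\{1,2,3,\dots\}.$$ (2) Furthermore, there is a measurable subset $\mathcal{Q}\subseteq[1/4,3/4]$ with Lebesgue measure at least $1/6$ such that if $q\in\mathcal{Q}$ then $$\limsup_{T\to\infty}\frac{T\phi^*-T\phi\left(\mathbb{E}[\overline X_1[T]],\mathbb{E}[\overline X_2[T]]\right)}{\log(T)}\ \ge\ \frac{3\beta^2}{2^{13}},\qquad\text{where }\beta=\frac23-\frac{\sqrt7}{6}\approx 0.2257.$$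
   Context: $\log$ is the natural logarithm. System: time is slotted, $t\in\{0,1,2,\dots\}$; the states $\{S[t]\}_{t=0}^\infty$ are i.i.d. Bernoulli with $P[S[t]=1]=q$, $P[S[t]=0]=1-q$. On every slot $t$ the controller observes $S[t]$ and chooses $X[t]=(X_1[t],X_2[t])\in\mathcal{D}(S[t])$, where $$\mathcal{D}(0)=\{(1,0)\},\qquad \mathcal{D}(1)=\{(r,1-r^2): r\in[0,1]\}.$$ For positive integers $T$, $\overline X_i[T]=\frac1T\sum_{t=0}^{T-1}X_i[t]$ for $i\in\{1,2\}$. Optimal utility: $\phi^*$ (which depends on $q$) is the supremum of $\liminf_{T\to\infty}\phi(\mathbb{E}[\overline X_1[T]],\mathbb{E}[\overline X_2[T]])$ over all algorithms, i.e. all processes of random vectors $\{X[t]\}_{t\ge0}$ with $X[t]\in\mathcal{D}(S[t])$ for all $t$, including randomized algorithms, algorithms knowing $q$, and non-causal algorithms knowing all future states. Statistics-unaware algorithm: a causal algorithm with no a-priori knowledge of $q$; that is, $X[t]=\hat X_t(U,S[0],\dots,S[t])\in\mathcal{D}(S[t])$ for all $t$, where $\{\hat X_t\}$ is a sequence of measurable functions not depending on $q$, and $U$ is a random seed uniform on $[0,1)$, independent of $\{S[t]\}$. Expectations are over $U$ and $\{S[t]\}$. $g(T)=\Omega(\log(T)/T)$ means there are constants $b>0$ and $T_0$ (not depending on $T$) with $g(T)\ge b\log(T)/T$ for all $T\ge T_0$. *)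

(* Defs.v *)
From HB Require Import structures.
From mathcomp Require Import all_boot all_order all_algebra finmap.
From mathcomp Require Import all_classical all_reals all_analysis.

Set Implicit Arguments.
Unset Strict Implicit.
Unset Printing Implicit Defensive.

Import Order.TTheory GRing.Theory Num.Theory.
Import numFieldNormedType.Exports.

Local Open Scope classical_set_scope.
Local Open Scope ring_scope.

Definition decision_set (R : realType) (s : bool) : set (R * R) :=
  if s then [set x | exists2 r : R, 0 <= r <= 1 & x = (r, 1 - r ^+ 2)]
  else [set (1, 0)].

Definition phi (R : realType) (x1 x2 : R) : R := ln (1 + x1) + ln (1 + x2).

Definition mutually_independent (R : realType) (d d' : measure_display)
    (Omega : measurableType d) (E : measurableType d')
    (P : probability Omega R) (S : nat -> {RV P >-> E}) : Prop :=
  forall (J : {fset nat}) (A : nat -> set E),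
    (forall t, measurable (A t)) ->
    P (\bigcap_(t in [set` J]) (S t @^-1` A t)) =
    (\prod_(t <- J) P (S t @^-1` A t))%E.

(* The state value 1 is [true] and 0 is [false]. *)
Definition bernoulli_iid (R : realType) (d : measure_display)
    (Omega : measurableType d) (P : probability Omega R) (q : R)
    (S : nat -> {RV P >-> bool}) : Prop :=
  (forall t, P (S t @^-1` [set true]) = q%:E) /\ mutually_independent S.

Definition events_of_process (R : realType) (d d' : measure_display)
    (Omega : measurableType d) (E : measurableType d')
    (P : probability Omega R) (S : nat -> {RV P >-> E}) : set (set Omega) :=
  <<s [set B | exists t, exists2 C, measurable C & B = S t @^-1` C] >>.

Definition independent_of_process (R : realType) (d d1 d2 : measure_display)
    (Omega : measurableType d) (E1 : measurableType d1)
    (E2 : measurableType d2) (P : probability Omega R)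
    (U : {RV P >-> E1}) (S : nat -> {RV P >-> E2}) : Prop :=
  forall A B, measurable A -> events_of_process S B ->
    P ((U @^-1` A) `&` B) = (P (U @^-1` A) * P B)%E.

(* [uniform_prob] lives on the closed interval; the endpoint 1 is a null set. *)
Definition uniform_seed (R : realType) (d : measure_display)
    (Omega : measurableType d) (P : probability Omega R)
    (U : {RV P >-> R}) : Prop :=
  (forall w, U w \in `[0, 1[) /\
  (forall A, measurable A -> distribution P U A = uniform_prob (@ltr01 R) A).

Definition time_average (R : realType) (Omega : Type)
    (Y : nat -> Omega -> R) (T : nat) (w : Omega) : R :=
  T%:R^-1 * \sum_(t < T) Y t w.

(* Decisions are bounded, so both expectations are finite and [fine] loses
   nothing. *)
Definition utility (R : realType) (d : measure_display)
    (Omega : measurableType d) (P : probability Omega R)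
    (X : nat -> Omega -> R * R) (T : nat) : R :=
  phi (fine 'E_P[time_average (fun t w => (X t w).1) T])
      (fine 'E_P[time_average (fun t w => (X t w).2) T]).

(* The sample space is part of the supremum: [X] is any process of random
   vectors on any space carrying the states, hence may use extra randomness,
   [q], and past and future states alike. *)
Definition phi_star (R : realType) (q : R) : \bar R :=
  ereal_sup [set v : \bar R |
    exists (d : measure_display) (Omega : measurableType d)
           (P : probability Omega R) (S : nat -> {RV P >-> bool})
           (X : nat -> {RV P >-> (R * R)%type}),
      [/\ bernoulli_iid q S,
          (forall t w, decision_set (S t w) (X t w)) &
          v = limn_einf (fun T => (utility P X T)%:E)]].

(* At slot [t] the algorithm sees the seed and the history S[0], ..., S[t]; the
   current state is the last component of the history. *)
Definition algorithm (R : realType) : Type :=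
  forall t : nat, R * t.+1.-tuple bool -> R * R.

Definition statistics_unaware (R : realType) (Xhat : algorithm R) : Prop :=
  forall t : nat,
    measurable_fun (`[0, 1[%classic `*` setT : set (R * t.+1.-tuple bool)%type)
      (Xhat t) /\
    forall (u : R) (s : t.+1.-tuple bool), u \in `[0, 1[ ->
      decision_set (tnth s ord_max) (Xhat t (u, s)).

Definition run (R : realType) (Omega : Type) (Xhat : algorithm R)
    (U : Omega -> R) (S : nat -> Omega -> bool) (t : nat) (w : Omega) : R * R :=
  Xhat t (U w, [tuple S i w | i < t.+1]).

Definition Omega_log_over_T (R : realType) (g : nat -> R) : Prop :=
  exists (b : R) (T0 : nat), 0 < b /\
    forall T : nat, (0 < T)%N -> (T0 <= T)%N -> b * ln T%:R / T%:R <= g T.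

Definition beta (R : realType) : R := 2 / 3 - Num.sqrt 7 / 6.

(* Main.v *)
From HB Require Import structures.
Require Import Defs.
From mathcomp Require Import all_boot all_order all_algebra finmap.
From mathcomp Require Import all_classical all_reals all_analysis.
From mathcomp Require Import measurable_realfun ring lra zify.

(** Falling short of the optimal utility amounts to an estimation error, and
    estimating a coin from [t] tosses costs an error of order [1 / t].

    Only a slot in state 1 leaves a choice, a rate [a] with decision
    [(a, 1 - a ^+ 2)].  Let [r] be the rate that maximises the utility among
    the constant ones.  At the resulting averages [(y1, y2)] the gradient of
    [phi] is [b * (2 * r, 1)] with [b = (1 + y2)^-1], and
    [2 * r * a + (1 - a ^+ 2) = 1 + r ^+ 2 - (a - r) ^+ 2].  Since [phi] lies
    below its tangent plane, [T] slots lose at least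
    [q * b * \sum_(t < T) 'E (a_t - r) ^+ 2] in total, where [a_t] is the rate
    planned for slot [t] from the seed and the earlier states.  Averaging over
    the seed does not increase the square, so one may think of [a_t] as a
    deterministic estimator of [r = optimal_rate q] from [t] tosses of a coin of
    bias [q] ([utility_gap]).  Because [optimal_rate] expands distances by
    at least [beta] ([optimal_rate_separates]), it estimates [q] as well.

    Two biases at distance [d] cannot be distinguished from much fewer than
    [d ^- 2] tosses: their Bhattacharyya affinity satisfies
    [affinity q q' ^+ 2 >= 1 - 4 / 3 * d ^+ 2], and a weighted
    arithmetic-geometric inequality turns this into a lower bound for the sum
    of the two estimation errors ([two_point_bound]).  Summed over the block of
    slots [4 ^ j <= t < 4 ^ j.+1], it shows that, of two biases whose distance
    is between [2 ^- j.+2] and [2 ^- j.+1], at least one suffers a total error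
    [beta ^+ 2 / 32] in block [j] ([block_error_pairwise_good]).  Such a bias is
    called good at scale [j]; logarithmic growth follows for every bias that is
    good at a positive fraction of the scales.

    For one bias and all horizons, nest intervals: of the outer quarters of an
    interval of length [2 ^- j.+1], one consists of good points only, and it has
    the length required two scales later.  The common point is good at every
    even scale ([pairwise_good_point]).

    For many biases and infinitely many horizons, cut [[1/4, 3/4]] into [2 ^ j]
    intervals: the points that are not good have diameter at most half
    the length in each, hence total measure at most [1/4].  By Markov's
    inequality the biases that are exceptional at more than three quarters of
    the first [K] scales have measure at most [1/3], which leaves [1/6] of the
    length [1/2]; continuity from above passes this on to the upper limit of
    these sets ([frequently_unexceptional]). *)

Set Implicit Arguments.
Unset Strict Implicit.
Unset Printing Implicit Defensive.

Import Order.TTheory GRing.Theory Num.Theory.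
Import numFieldNormedType.Exports.

Local Open Scope classical_set_scope.
Local Open Scope ring_scope.

(** * The optimal constant rate *)

(** The root in [[0, 1]] of the first-order condition [optimal_rate_eq] for
    maximising [phi (1 - q + q * r) (q * (1 - r ^+ 2))] over [r]. *)
Definition optimal_rate (R : realType) (q : R) : R :=
  (q - 2 + Num.sqrt (4 - q + 4 * q ^+ 2)) / (3 * q).

Lemma optimal_rate_eq (R : realType) (q : R) : 1 / 4 <= q <= 3 / 4 ->
  3 * q * optimal_rate q ^+ 2 + 2 * (2 - q) * optimal_rate q = 1 + q.
Proof.
move=> /andP[q1 q2]; rewrite /optimal_rate.
have z2 : Num.sqrt (4 - q + 4 * q ^+ 2) ^+ 2 = 4 - q + 4 * q ^+ 2.
  by rewrite sqr_sqrtr//; nra.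
set z := Num.sqrt _ in z2 *.
have q0 : q != 0 by apply/eqP; lra.
have -> : 3 * q * ((q - 2 + z) / (3 * q)) ^+ 2 +
          2 * (2 - q) * ((q - 2 + z) / (3 * q)) =
          (z ^+ 2 - (2 - q) ^+ 2) / (3 * q).
  by field.
by rewrite z2; field.
Qed.

Lemma optimal_rate_bounds (R : realType) (q : R) : 1 / 4 <= q <= 3 / 4 ->
  1 / 3 <= optimal_rate q <= 1 / 2.
Proof.
move=> /andP[q1 q2]; rewrite /optimal_rate.
have z2 : Num.sqrt (4 - q + 4 * q ^+ 2) ^+ 2 = 4 - q + 4 * q ^+ 2.
  by rewrite sqr_sqrtr//; nra.
have z0 := sqrtr_ge0 (4 - q + 4 * q ^+ 2).
set z := Num.sqrt _ in z0 z2 *.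
rewrite ler_pdivlMr ?ler_pdivrMr; [|lra|lra].
by apply/andP; split; nra.
Qed.

Lemma beta_sqr_le (R : realType) : beta R ^+ 2 <= 1 / 16.
Proof.
rewrite /beta.
have z0 := sqrtr_ge0 (7 : R).
have z2 : Num.sqrt (7 : R) ^+ 2 = 7 by rewrite sqr_sqrtr.
set z := Num.sqrt _ in z0 z2 *.
have ? : 5 / 2 <= z by nra.
have ? : z <= 4 by nra.
nra.
Qed.

(** The equation of the optimal rate is affine in [q], hence
    [q = (4 * r - 1) / ((1 - r) * (3 * r + 1))], and on [[1/3, 1/2]] this
    function of [r] is Lipschitz with constant [4 <= beta ^-1]. *)
Lemma optimal_rate_separates (R : realType) (q q' : R) :
  1 / 4 <= q <= 3 / 4 -> 1 / 4 <= q' <= 3 / 4 ->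
  beta R ^+ 2 * (q - q') ^+ 2 <= (optimal_rate q - optimal_rate q') ^+ 2.
Proof.
move=> hq hq'; have e := optimal_rate_eq hq; have e' := optimal_rate_eq hq'.
have /andP[b1 b2] := optimal_rate_bounds hq.
have /andP[b1' b2'] := optimal_rate_bounds hq'.
set r := optimal_rate q in e b1 b2 *.
set s := optimal_rate q' in e' b1' b2' *.
pose D x : R := (1 - x) * (3 * x + 1).
have Dq : q * D r = 4 * r - 1 by rewrite /D; lra.
have Dq' : q' * D s = 4 * s - 1 by rewrite /D; lra.
have Dr : 5 / 4 <= D r by rewrite /D; nra.
have Ds : 5 / 4 <= D s by rewrite /D; nra.
(* [N / (D r * D s)] is the difference quotient of [q] between [r] and [s]. *)
pose N : R := 6 + 12 * (r * s) - 3 * (r + s).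
have key : (q - q') * (D r * D s) = (r - s) * N.
  have -> : (q - q') * (D r * D s) = (q * D r) * D s - (q' * D s) * D r by ring.
  by rewrite Dq Dq' /D /N; ring.
have N0 : 0 <= N by rewrite /N; nra.
have N1 : N <= 25 / 4.
  have ? : 0 <= (1 / 2 - r) * (1 / 2 - s) by apply: mulr_ge0; lra.
  by rewrite /N; nra.
have DD : 25 / 16 <= D r * D s by nra.
have lip : (q - q') ^+ 2 <= 16 * (r - s) ^+ 2.
  have : ((q - q') * (D r * D s)) ^+ 2 = ((r - s) * N) ^+ 2 by rewrite key.
  rewrite [LHS]exprMn [RHS]exprMn => h.
  have P2 : (25 / 16) ^+ 2 <= (D r * D s) ^+ 2 by nra.
  have N2 : N ^+ 2 <= (25 / 4) ^+ 2 by nra.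
  have := sqr_ge0 (q - q'); have := sqr_ge0 (r - s).
  move: h P2 N2.
  set x := (q - q') ^+ 2; set y := (r - s) ^+ 2; set P := (D r * D s) ^+ 2.
  set M := N ^+ 2; move=> h P2 N2 y0 x0.
  have : x * (25 / 16) ^+ 2 <= y * (25 / 4) ^+ 2.
    apply: (@le_trans _ _ (x * P)); first exact: ler_wpM2l.
    by rewrite h; exact: ler_wpM2l.
  lra.
have := beta_sqr_le R; have := sqr_ge0 (q - q'); have := sqr_ge0 (beta R).
nra.
Qed.

(** * Estimating a bias from coin tosses *)

Definition coin (R : realType) (q : R) (b : bool) : R := if b then q else 1 - q.

(** The last entry of a history is the current state; the tosses available to
    an estimator are the ones before it, so the last entry carries no weight. *)
Definition past_weight (R : realType) (F : bool -> R) (t : nat)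
    (h : t.+1.-tuple bool) : R :=
  \prod_(i < t) F (tnth h (widen_ord (leqnSn t) i)).

(** Used with [F = coin q] for total probabilities, and with the geometric mean
    of two coins for the affinity of two product laws. *)
Lemma sum_past_weight (R : realType) (F : bool -> R) (t : nat) (b : bool) :
  \sum_(h : t.+1.-tuple bool | tnth h ord_max == b) past_weight F h =
  (F true + F false) ^+ t.
Proof.
pose tup (f : {ffun 'I_t.+1 -> bool}) : t.+1.-tuple bool :=
  [tuple f i | i < t.+1].
rewrite (reindex tup)/=; last first.
  exists (fun h => [ffun i => tnth h i]) => [f _|h _].
    by apply/ffunP => i; rewrite ffunE tnth_mktuple.
  by apply: eq_from_tnth => i; rewrite tnth_mktuple ffunE.
pose G (i : 'I_t.+1) (c : bool) : R :=
  if i == ord_max then (c == b)%:R else F c.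
have <- : \prod_(i < t.+1) \sum_c G i c = (F true + F false) ^+ t.
  rewrite big_ord_recr/= (eq_bigr (fun=> F true + F false)) => [|i _].
    rewrite prodr_const card_ord big_bool /G eqxx.
    by case: (b) => /=; rewrite ?addr0 ?add0r mulr1.
  by rewrite big_bool /G -val_eqE/= ltn_eqF.
rewrite bigA_distr_bigA/= big_mkcond/=; apply: eq_bigr => f _.
rewrite big_ord_recr/= /G eqxx tnth_mktuple; case: eqP => _; last by rewrite mulr0.
rewrite mulr1 /past_weight; apply: eq_bigr => i _.
by rewrite -val_eqE/= ltn_eqF// tnth_mktuple; congr F.
Qed.

Lemma past_weight_coin_ge0 (R : realType) (q : R) (t : nat)
  (h : t.+1.-tuple bool) : 0 <= q <= 1 -> 0 <= past_weight (coin q) h.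
Proof.
by move=> /andP[q0 q1]; apply: prodr_ge0 => i _; rewrite /coin; case: ifP; lra.
Qed.

Definition estimation_error (R : realType) (t : nat)
    (A : t.+1.-tuple bool -> R) (theta q : R) : R :=
  \sum_(h : t.+1.-tuple bool | tnth h ord_max == true)
    past_weight (coin q) h * (A h - theta) ^+ 2.

Lemma estimation_error_ge0 (R : realType) (t : nat)
    (A : t.+1.-tuple bool -> R) (theta q : R) :
  0 <= q <= 1 -> 0 <= estimation_error A theta q.
Proof.
move=> q01; apply: sumr_ge0 => h _.
by rewrite mulr_ge0 ?sqr_ge0 ?past_weight_coin_ge0.
Qed.

Lemma bernoulli_inequality (R : realType) (x : R) (n : nat) :
  0 <= x <= 1 -> 1 - n%:R * x <= (1 - x) ^+ n.
Proof.
move=> /andP[x0 x1]; elim: n => [|n IH]; first by rewrite mul0r subr0 expr0.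
rewrite exprS -natr1; apply: (@le_trans _ _ ((1 - x) * (1 - n%:R * x))).
  have : 0 <= n%:R :> R by []. nra.
by apply: ler_wpM2l => //; lra.
Qed.

(** Bhattacharyya coefficient of two coins; it is multiplicative over
    independent tosses. *)
Definition affinity (R : realType) (q q' : R) : R :=
  Num.sqrt (coin q true) * Num.sqrt (coin q' true) +
  Num.sqrt (coin q false) * Num.sqrt (coin q' false).

(** With [q = sin x ^+ 2] and [q' = sin y ^+ 2] the affinity is [cos (x - y)],
    so that its square is one minus [sin (x - y) ^+ 2], and [sin (x - y)] equals
    [q - q'] divided by [sin (x + y)].  The proof does this with square roots. *)
Lemma affinity_lower (R : realType) (q q' : R) :
  1 / 4 <= q <= 3 / 4 -> 1 / 4 <= q' <= 3 / 4 ->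
  1 - 4 / 3 * (q - q') ^+ 2 <= affinity q q' ^+ 2.
Proof.
move=> /andP[q1 q2] /andP[p1 p2]; rewrite /affinity /coin.
have : Num.sqrt q ^+ 2 = q by rewrite sqr_sqrtr//; lra.
have : Num.sqrt q' ^+ 2 = q' by rewrite sqr_sqrtr//; lra.
have : Num.sqrt (1 - q) ^+ 2 = 1 - q by rewrite sqr_sqrtr//; lra.
have : Num.sqrt (1 - q') ^+ 2 = 1 - q' by rewrite sqr_sqrtr//; lra.
have := sqrtr_ge0 q; have := sqrtr_ge0 q'.
have := sqrtr_ge0 (1 - q); have := sqrtr_ge0 (1 - q').
set a := Num.sqrt q; set a' := Num.sqrt q'.
set b := Num.sqrt (1 - q); set b' := Num.sqrt (1 - q').
move=> b'0 b0 a'0 a0 Eb' Eb Ea' Ea.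
have pyth : (a * a' + b * b') ^+ 2 + (a * b' - a' * b) ^+ 2 = 1.
  have -> : (a * a' + b * b') ^+ 2 + (a * b' - a' * b) ^+ 2 =
            (a ^+ 2 + b ^+ 2) * (a' ^+ 2 + b' ^+ 2) by ring.
  by rewrite Eb Eb' Ea Ea'; ring.
have fact : (a * b' - a' * b) * (a * b' + a' * b) = q - q'.
  have -> : (a * b' - a' * b) * (a * b' + a' * b) =
            a ^+ 2 * b' ^+ 2 - a' ^+ 2 * b ^+ 2 by ring.
  by rewrite Eb Eb' Ea Ea'; ring.
have prod_ge : 3 / 16 <= a * b' * (a' * b).
  have v : forall x : R, 1 / 4 <= x -> x <= 3 / 4 -> 3 / 16 <= x * (1 - x).
    by move=> x ? ?; nra.
  have E : (a * b' * (a' * b)) ^+ 2 = (q * (1 - q)) * (q' * (1 - q')).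
    have -> : (a * b' * (a' * b)) ^+ 2 =
      (a ^+ 2 * b ^+ 2) * (a' ^+ 2 * b' ^+ 2) by ring.
    by rewrite Eb Eb' Ea Ea'.
  have ? := v _ q1 q2; have ? := v _ p1 p2.
  have : (3 / 16) ^+ 2 <= (a * b' * (a' * b)) ^+ 2 by rewrite E; nra.
  rewrite ler_pXn2r// ?nnegrE; first lra.
  by rewrite !mulr_ge0.
have sum_ge : 3 / 4 <= (a * b' + a' * b) ^+ 2.
  have := sqr_ge0 (a * b' - a' * b); nra.
have : (a * b' - a' * b) ^+ 2 * (a * b' + a' * b) ^+ 2 = (q - q') ^+ 2.
  by rewrite -fact exprMn.
have := sqr_ge0 (a * b' - a' * b); nra.
Qed.

(** An estimate at distances [x] and [y] from two targets, in the situation where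
    the history has weights [g ^+ 2] and [g' ^+ 2] under the two laws.  The
    minimum of the right-hand side for fixed [y - x] is the harmonic expression
    [(g * g') ^+ 2 / (g ^+ 2 + g' ^+ 2)] times [(y - x) ^+ 2]; the free
    parameter [l] makes the bound linear in [g * g'] and in the weights, so that
    it can be summed over histories. *)
Lemma two_point_pointwise (R : realType) (g g' x y l : R) :
  (y - x) ^+ 2 * (2 * l * (g * g') - l ^+ 2 * (g ^+ 2 + g' ^+ 2)) <=
  g ^+ 2 * x ^+ 2 + g' ^+ 2 * y ^+ 2.
Proof.
have [s0|s0] := eqVneq (g ^+ 2 + g' ^+ 2) 0.
  have g0 : g = 0.
    by apply/eqP; have := sqr_ge0 g; have := sqr_ge0 g'; rewrite -sqrf_eq0; lra.
  have g'0 : g' = 0.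
    by apply/eqP; have := sqr_ge0 g; have := sqr_ge0 g'; rewrite -sqrf_eq0; lra.
  by rewrite g0 g'0; lra.
have sp : 0 < g ^+ 2 + g' ^+ 2 by rewrite lt0r s0 addr_ge0 ?sqr_ge0.
rewrite -(ler_pM2l sp) -subr_ge0.
have -> : (g ^+ 2 + g' ^+ 2) * (g ^+ 2 * x ^+ 2 + g' ^+ 2 * y ^+ 2) -
  (g ^+ 2 + g' ^+ 2) *
   ((y - x) ^+ 2 * (2 * l * (g * g') - l ^+ 2 * (g ^+ 2 + g' ^+ 2))) =
  (g ^+ 2 * x + g' ^+ 2 * y) ^+ 2 +
  ((y - x) * (g * g' - l * (g ^+ 2 + g' ^+ 2))) ^+ 2 by ring.
by rewrite addr_ge0 ?sqr_ge0.
Qed.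

(** Le Cam's two-point method: an estimator cannot be close to two separated
    targets under two laws that nearly coincide. *)
Lemma two_point_bound (R : realType) (t : nat) (A : t.+1.-tuple bool -> R)
    (theta theta' q q' : R) :
  1 / 4 <= q <= 3 / 4 -> 1 / 4 <= q' <= 3 / 4 ->
  (theta - theta') ^+ 2 / 2 * (1 - 4 / 3 * t%:R * (q - q') ^+ 2) <=
  estimation_error A theta q + estimation_error A theta' q'.
Proof.
move=> hq hq'.
set rho := affinity q q' ^+ t.
pose g p (h : t.+1.-tuple bool) : R :=
  past_weight (fun b => Num.sqrt (coin p b)) h.
have gE p h : 1 / 4 <= p <= 3 / 4 -> g p h ^+ 2 = past_weight (coin p) h.
  move=> /andP[? ?]; rewrite /g /past_weight -prodrXl; apply: eq_bigr => i _.
  by rewrite sqr_sqrtr// /coin; case: ifP; lra.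
have sg p : 1 / 4 <= p <= 3 / 4 ->
    \sum_(h : t.+1.-tuple bool | tnth h ord_max == true) g p h ^+ 2 = 1.
  move=> hp; under eq_bigr => h _ do rewrite gE//.
  by rewrite sum_past_weight /coin addrC subrK expr1n.
have sgg : \sum_(h : t.+1.-tuple bool | tnth h ord_max == true)
    g q h * g q' h = rho.
  rewrite /rho /affinity -[RHS](sum_past_weight
    (fun b => Num.sqrt (coin q b) * Num.sqrt (coin q' b)) t true).
  by apply: eq_bigr => h _; rewrite /g /past_weight -big_split.
apply: (@le_trans _ _ ((theta - theta') ^+ 2 / 2 * rho ^+ 2)).
  apply: ler_wpM2l; first by rewrite divr_ge0 ?sqr_ge0.
  rewrite /rho -exprM mulnC exprM.
  apply: (@le_trans _ _ ((1 - 4 / 3 * (q - q') ^+ 2) ^+ t)).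
    have d01 : 0 <= 4 / 3 * (q - q') ^+ 2 <= 1.
      move: hq hq' => /andP[? ?] /andP[? ?]; apply/andP; split; last nra.
      by rewrite mulr_ge0 ?sqr_ge0//; lra.
    apply: le_trans (bernoulli_inequality t d01); lra.
  rewrite lerXn2r// ?nnegrE ?sqr_ge0//; last exact: affinity_lower.
  by move: hq hq' => /andP[? ?] /andP[? ?]; nra.
(* [l = rho / 2] maximises [2 * l * rho - 2 * l ^+ 2]. *)
have -> : (theta - theta') ^+ 2 / 2 * rho ^+ 2 =
   \sum_(h : t.+1.-tuple bool | tnth h ord_max == true)
    (theta - theta') ^+ 2 * (2 * (rho / 2) * (g q h * g q' h) -
      (rho / 2) ^+ 2 * (g q h ^+ 2 + g q' h ^+ 2)).
  rewrite -mulr_sumr sumrB -!mulr_sumr big_split/= !sg// sgg. by field.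
rewrite /estimation_error -[leRHS]big_split/=; apply: ler_sum => h _.
rewrite -!gE//.
have := two_point_pointwise (g q h) (g q' h) (A h - theta) (A h - theta') (rho / 2).
by rewrite (_ : A h - theta' - (A h - theta) = theta - theta'); last ring.
Qed.

(** * Errors over dyadic blocks of slots *)

Definition block_error (R : realType) (A : forall t, t.+1.-tuple bool -> R)
    (j : nat) (q : R) : R :=
  \sum_(4 ^ j <= t < 4 ^ j.+1) estimation_error (A t) (optimal_rate q) q.

Lemma sum_nat_le (R : realType) (m n : nat) : (m <= n)%N ->
  \sum_(m <= t < n) t%:R <= (n%:R ^+ 2 - m%:R ^+ 2) / 2 :> R.
Proof.
move=> mn.
have -> : (n%:R ^+ 2 - m%:R ^+ 2) / 2 =
    \sum_(m <= t < n) (t.+1%:R ^+ 2 - t%:R ^+ 2) / 2 :> R.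
  by rewrite -mulr_suml (telescope_sumr (fun t => t%:R ^+ 2)).
apply: ler_sum => t _; rewrite -natr1.
have : 0 <= t%:R :> R by []. nra.
Qed.

(** The number of slots in block [j] compensates the squared distance: with
    [n = 4 ^ j] and [x = n * (q - q') ^+ 2] in [[1/16, 1/4]], the two-point
    bounds add up to [beta ^+ 2 * x * (3 - 10 * x) / 2], which is concave in [x]
    and at least [beta ^+ 2 / 16] at both ends. *)
Lemma block_two_point (R : realType) (A : forall t, t.+1.-tuple bool -> R)
    (j : nat) (q q' : R) :
  1 / 4 <= q <= 3 / 4 -> 1 / 4 <= q' <= 3 / 4 ->
  (1 / 2) ^+ j.+2 <= `|q - q'| <= (1 / 2) ^+ j.+1 ->
  beta R ^+ 2 / 16 <= block_error A j q + block_error A j q'.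
Proof.
move=> hq hq' /andP[d1 d2].
set n : R := (4 ^ j)%:R; set b := beta R ^+ 2.
have b0 : 0 <= b := sqr_ge0 _.
have n0 : 0 < n by rewrite ltr0n expn_gt0.
have n4 : (4 ^ j.+1)%:R = 4 * n :> R by rewrite expnS natrM.
set d2' := (q - q') ^+ 2.
have nh k : n * ((1 / 2) ^+ (j + k)) ^+ 2 = (1 / 4) ^+ k :> R.
  rewrite -exprM mulnC exprM (_ : (1 / 2) ^+ 2 = 1 / 4); last by field.
  rewrite exprD mulrA /n natrX -exprMn (_ : 4 * (1 / 4) = 1); last by field.
  by rewrite expr1n [LHS]mul1r.
have x1 : 1 / 16 <= n * d2'.
  have := nh 2; rewrite addn2 (_ : (1 / 4) ^+ 2 = 1 / 16); last by field.
  move=> <-; apply: ler_wpM2l; first exact: ltW.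
  by rewrite /d2' -(real_normK (num_real (q - q'))) lerXn2r// nnegrE//.
have x2 : n * d2' <= 1 / 4.
  have := nh 1; rewrite addn1 expr1.
  move=> <-; apply: ler_wpM2l; first exact: ltW.
  by rewrite /d2' -(real_normK (num_real (q - q'))) lerXn2r// nnegrE//.
apply: (@le_trans _ _ (\sum_(4 ^ j <= t < 4 ^ j.+1)
    (b * d2' / 2 - b * d2' / 2 * (4 / 3 * d2') * t%:R))); last first.
  rewrite /block_error -big_split/=; apply: ler_sum => t _.
  (* Multiplying by the factor of [two_point_bound] needs its sign; where it is
     negative, the summand is bounded by zero. *)
  have [le0|ge0] := lerP (1 - 4 / 3 * t%:R * d2') 0.
    apply: (@le_trans _ _ 0).
      have : 0 <= b * d2' / 2 by rewrite divr_ge0// mulr_ge0// sqr_ge0.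
      nra.
    by rewrite addr_ge0// estimation_error_ge0//; move: hq hq' => /andP[? ?] /andP[? ?]; lra.
  apply: le_trans (two_point_bound (A t) _ _ hq hq').
  have := optimal_rate_separates hq hq'; rewrite -/b -/d2'.
  set D := (optimal_rate q - optimal_rate q') ^+ 2 => bD.
  have -> : b * d2' / 2 - b * d2' / 2 * (4 / 3 * d2') * t%:R =
     b * d2' / 2 * (1 - 4 / 3 * t%:R * d2') by ring.
  by apply: ler_wpM2r; [exact: ltW|lra].
rewrite sumrB sumr_const_nat -mulr_sumr.
have -> : b * d2' / 2 *+ (4 ^ j.+1 - 4 ^ j) = b * d2' / 2 * (3 * n).
  rewrite -mulr_natr natrB ?n4; last by rewrite leq_exp2l.
  rewrite -/n; ring.
have := @sum_nat_le R (4 ^ j) (4 ^ j.+1) ltac:(by rewrite leq_exp2l).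
rewrite n4 -/n; set s := \sum_(_ <= _ < _) _ => hs.
have c0 : 0 <= b * d2' / 2 * (4 / 3 * d2').
  have d0 : 0 <= d2' := sqr_ge0 _.
  have bd0 := mulr_ge0 b0 d0.
  by apply: mulr_ge0; lra.
have h := ler_wpM2l c0 hs.
apply: (@le_trans _ _ (b * d2' / 2 * (3 * n) -
   b * d2' / 2 * (4 / 3 * d2') * (((4 * n) ^+ 2 - n ^+ 2) / 2))); last lra.
have -> : b * d2' / 2 * (3 * n) -
   b * d2' / 2 * (4 / 3 * d2') * (((4 * n) ^+ 2 - n ^+ 2) / 2) =
   b * ((n * d2') * (3 - 10 * (n * d2')) / 2) by field.
rewrite -[b / 16]/(b * 16^-1); apply: ler_wpM2l => //.
by move: x1 x2; set x := n * d2' => x1 x2; nra.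
Qed.

(** What the rest of the argument retains from the two-point bounds. *)
Definition pairwise_good (R : realType) (good : nat -> R -> Prop) : Prop :=
  forall (j : nat) (q q' : R), 1 / 4 <= q <= 3 / 4 -> 1 / 4 <= q' <= 3 / 4 ->
  (1 / 2) ^+ j.+2 <= `|q - q'| <= (1 / 2) ^+ j.+1 -> good j q \/ good j q'.

Lemma block_error_pairwise_good (R : realType)
    (A : forall t, t.+1.-tuple bool -> R) :
  pairwise_good (fun j q => beta R ^+ 2 / 32 <= block_error A j q).
Proof.
move=> j q q' hq hq' d; have := block_two_point A hq hq' d.
by case: (lerP (beta R ^+ 2 / 32) (block_error A j q)) => [|?]; [left|right; lra].
Qed.

(** Points of the two outer quarters are at a distance between half the length
    and the length, so a single failure on the left forces the whole right
    quarter to be good. *)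
Lemma pairwise_good_quarter (R : realType) (good : nat -> R -> Prop)
    (j : nat) (a : R) : pairwise_good good ->
  1 / 4 <= a -> a + (1 / 2) ^+ j.+1 <= 3 / 4 ->
  (forall q, a <= q <= a + (1 / 2) ^+ j.+3 -> good j q) \/
  (forall q, a + 3 * (1 / 2) ^+ j.+3 <= q <= a + 4 * (1 / 2) ^+ j.+3 ->
    good j q).
Proof.
move=> pg a1; rewrite (_ : (1 / 2) ^+ j.+1 = 4 * (1 / 2) ^+ j.+3); last first.
  by rewrite !exprS; field.
set l := (1 / 2) ^+ j.+3 => a2.
have l0 : 0 < l by rewrite exprn_gt0//; lra.
have [|/existsNP[q /not_implyP[/andP[q1 q2] ngq]]] :=
  pselect (forall q, a <= q <= a + l -> good j q); first by left.
right=> q' /andP[q'1 q'2].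
have [] := pg j q q' => //; [by apply/andP; split; lra..|].
rewrite distrC ger0_norm; last lra.
rewrite (_ : (1 / 2) ^+ j.+2 = 2 * l); last by rewrite /l !exprS; field.
rewrite (_ : (1 / 2) ^+ j.+1 = 4 * l); last by rewrite /l !exprS; field.
by apply/andP; split; lra.
Qed.

(** * A bias that is good at every even scale *)

(** The intervals of [pairwise_good_quarter] shrink by a factor 4, that is by two
    scales, at each step; hence the doubling of [k]. *)
Lemma pairwise_good_point (R : realType) (good : nat -> R -> Prop) :
  pairwise_good good ->
  exists2 q, 1 / 4 <= q <= 3 / 4 & forall k, good k.*2 q.
Proof.
move=> pg; pose l k : R := (1 / 2) ^+ k.*2.+1.
have lS k : l k = 4 * l k.+1 by rewrite /l doubleS !exprS; field.
have l0 k : 0 < l k by rewrite exprn_gt0//; lra.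
have step k (a : R) : exists a', (1 / 4 <= a /\ a + l k <= 3 / 4) ->
    [/\ a <= a', a' + l k.+1 <= a + l k &
      forall q, a' <= q <= a' + l k.+1 -> good k.*2 q].
  have [[a1 a2]|] := pselect (1 / 4 <= a /\ a + l k <= 3 / 4); last by exists a.
  have := l0 k.+1; have := lS k.
  case: (pairwise_good_quarter pg a1 a2) => h e p.
    by exists a => _; split => [//||//]; lra.
  exists (a + 3 * l k.+1) => _; split; [lra|lra|move=> q hq; apply: h].
  by move: hq; rewrite /l doubleS => /andP[? ?]; apply/andP; split; lra.
pose nxt k a := projT1 (cid (step k a)).
have nxtP k a := projT2 (cid (step k a)).
pose u := fix u k := if k is k'.+1 then nxt k' (u k') else 1 / 4.
have u_next k : 1 / 4 <= u k /\ u k + l k <= 3 / 4 ->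
    [/\ u k <= u k.+1, u k.+1 + l k.+1 <= u k + l k &
     forall q, u k.+1 <= q <= u k.+1 + l k.+1 -> good k.*2 q].
  exact: nxtP.
have range_u k : 1 / 4 <= u k /\ u k + l k <= 3 / 4.
  elim: k => [|k IH]; first by rewrite /l /= expr1; split; lra.
  by have [? ? _] := u_next k IH; have [? ?] := IH; split; lra.
have u_step k := u_next k (range_u k).
have u_mono m n : (m <= n)%N -> u m <= u n /\ u n + l n <= u m + l m.
  elim: n => [|n IH]; first by rewrite leqn0 => /eqP ->.
  rewrite leq_eqVlt ltnS => /predU1P[->//|/IH[? ?]].
  by have [? ? _] := u_step n; split; lra.
have ub k : ubound (range u) (u k + l k).
  move=> _ [m _ <-]; case: (leqP m k) => [/u_mono[? _]|/ltnW/u_mono[_ ?]].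
    by have := l0 k; lra.
  by have := l0 m; lra.
have ne : range u !=set0 by exists (u 0); exists 0%N.
have lo k : u k <= sup (range u).
  by apply: ub_le_sup; [exists (u 0 + l 0); exact: ub|exists k].
have hi k : sup (range u) <= u k + l k by apply: ge_sup => //; exact: ub.
exists (sup (range u)).
  by have [? ?] := range_u 0; have := lo 0; have := hi 0; lra.
by move=> k; have [_ _] := u_step k; apply; rewrite lo hi.
Qed.

(** * Biases that are good at many scales *)

(** Covering the failures by intervals makes the exceptional set measurable
    whatever [good] is.  In each of the [2 ^ j] pieces of [[1/4, 3/4]], two
    failures are less than half a piece apart, so an interval of that length,
    starting at their infimum, contains them. *)
Lemma pairwise_good_exceptional_set (R : realType) (good : nat -> R -> Prop)
    (j : nat) : pairwise_good good ->
  exists B : set R, [/\ measurable B, (lebesgue_measure B <= (1 / 4)%:E)%E &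
    forall q, 1 / 4 <= q <= 3 / 4 -> ~ B q -> good j q].
Proof.
move=> pg; pose h : R := (1 / 2) ^+ j.+2.
have h0 : 0 < h by rewrite exprn_gt0//; lra.
have hE : (1 / 2) ^+ j.+1 = 2 * h by rewrite /h [in RHS]exprS; field.
pose bad i : set R := [set q | [/\ 1 / 4 + i%:R * (2 * h) <= q,
  q <= 1 / 4 + i.+1%:R * (2 * h), 1 / 4 <= q <= 3 / 4 & ~ good j q]].
pose J i : set R := `[inf (bad i), inf (bad i) + h]%classic.
have mJ i : measurable (J i) by exact: measurable_itv.
have muJ i : lebesgue_measure (J i) = h%:E.
  rewrite /J lebesgue_measure_itv/= lte_fin ltrDl h0 -EFinD; congr (_%:E); ring.
have total : (2 ^ j)%:R * (2 * h) = 1 / 2 :> R.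
  rewrite natrX -hE exprS mulrCA -exprMn (_ : 2 * (1 / 2) = 1); last by field.
  by rewrite expr1n mulr1.
exists (\big[setU/set0]_(i < 2 ^ j) J i); split.
- exact: bigsetU_measurable.
- apply: le_trans; first by apply: (Boole_inequality lebesgue_measure) => i _; exact: mJ.
  rewrite (eq_bigr (fun=> h%:E)) => [|i _].
    rewrite sumEFin lee_fin sumr_const card_ord -mulr_natl; lra.
  exact: muJ.
- move=> q hq nB; apply: contrapT => ngq; apply: nB.
  have [i iN qi] : exists2 i, (i < 2 ^ j)%N & bad i q.
    have cover N (x : R) : (0 < N)%N -> 0 <= x <= N%:R ->
        exists2 i, (i < N)%N & i%:R <= x <= i.+1%:R.
      elim: N => // N IH _ /andP[x0 xN].
      have [Nx|xN'] := lerP N%:R x; first by exists N => //; rewrite Nx.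
      case: N => [|N] in IH xN xN' *; first lra.
      have [//| |i iN hi] := IH; first by rewrite x0 ltW.
      by exists i => //; rewrite ltnS ltnW.
    have [| |i iN /andP[i1 i2]] := cover (2 ^ j)%N ((q - 1 / 4) / (2 * h)).
    - by rewrite expn_gt0.
    - move: hq => /andP[? ?]; rewrite divr_ge0 ?ler_pdivrMr/= ?total; lra.
    - exists i => //; move: i1 i2; rewrite ler_pdivlMr ?ler_pdivrMr; [|lra..].
      by move=> ? ?; split => //; lra.
  rewrite -bigcup_mkord; exists i => //=; rewrite /J/= in_itv/=.
  have lb : lbound (bad i) (1 / 4) by move=> y [? ? /andP[]].
  apply/andP; split; first by apply: ge_inf => //; exists (1 / 4).
  rewrite -lerBlDr; apply: lb_le_inf; first by exists q.
  move=> y [y1 y2 hy ngy]; rewrite leNgt; apply/negP => yq.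
  case: qi => q1 q2 _ _.
  have [] := pg j q y hq hy => //.
  rewrite hE -/h ger0_norm; last lra.
  apply/andP; split; first lra.
  by move: q2 y1; rewrite -natr1; lra.
Qed.

(** Markov's inequality: the number of exceptional scales below [K] has integral
    at most [K / 4], so it exceeds [3 / 4 * K] on a set of measure at most [1/3],
    and [1/2 - 1/3 = 1/6]. *)
Lemma measure_mostly_unexceptional (R : realType) (B : nat -> set R) (K : nat) :
  (0 < K)%N ->
  (forall j, measurable (B j)) ->
  (forall j, (lebesgue_measure (B j) <= (1 / 4)%:E)%E) ->
  let F := [set q : R | 1 / 4 <= q <= 3 / 4 /\
                        \sum_(j < K) (\1_(B j) q : R) <= 3 / 4 * K%:R] in
  measurable F /\ ((1 / 6)%:E <= lebesgue_measure F)%E.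
Proof.
move=> K0 mB muB F; pose mu := @lebesgue_measure R.
pose I : set R := `[1 / 4, 3 / 4]%classic.
have mB' j : measurable (B j : set (measurableTypeR R)) := mB j.
have mI : measurable (I : set (measurableTypeR R)) by exact: measurable_itv.
have muI : mu I = (1 / 2)%:E.
  rewrite /mu /I lebesgue_measure_itv/= lte_fin ifT; last lra.
  by rewrite -EFinD; congr (_%:E); field.
have IP q : I q = (1 / 4 <= q <= 3 / 4) by rewrite /I/= in_itv.
pose h (q : R) : R := \sum_(j < K) \1_(B j) q.
have mh D : measurable D -> measurable_fun D h.
  by move=> mD; apply: measurable_sum => j; exact: measurable_indic.
have FE : F = I `&` [set q | h q <= 3 / 4 * K%:R].
  by apply/seteqP; split => q; rewrite /F/= IP.
have mF : measurable F.
  by rewrite FE; apply: measurable_fun_le => //; exact: mh.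
split=> //.
pose G := I `\` F.
have mG : measurable (G : set (measurableTypeR R)) by exact: measurableD.
have muG : (mu G <= (1 / 3)%:E)%E.
  pose c : R := 3 / 4 * K%:R.
  have c0 : 0 < c by rewrite mulr_gt0 ?ltr0n//; lra.
  have : (c%:E * mu G <= (K%:R / 4)%:E)%E.
    apply: (@le_trans _ _ (\int[mu]_(q in I) (h q)%:E)%E); last first.
      under eq_integral => q _ do rewrite /h -sumEFin.
      rewrite ge0_integral_sum//; last first.
        by move=> j; apply/measurable_EFinP; exact: measurable_indic.
      apply: (@le_trans _ _ (\sum_(j < K) (1 / 4 : R))%:E).
        rewrite -sumEFin; apply: lee_sum => j _; rewrite integral_indic//.
        apply: le_trans (muB j); apply: le_measure; rewrite ?inE//.
        exact: measurableI.
      by rewrite lee_fin sumr_const card_ord -mulr_natl; lra.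
    have -> : (c%:E * mu G = \int[mu]_(q in I) (c * \1_G q)%:E)%E.
      under eq_integral do rewrite EFinM.
      rewrite ge0_integralZl//; last 2 first.
      - by apply/measurable_EFinP; apply: measurable_indic; exact: mG.
      - by rewrite lee_fin ltW.
      by rewrite integral_indic// setIidl// /G => q [].
    apply: ge0_le_integral => //.
    - by move=> q _; rewrite lee_fin mulr_ge0// ltW.
    - apply/measurable_EFinP; apply: measurable_funM.
        exact: measurable_cst.
      exact: measurable_indic.
    - by apply/measurable_EFinP; exact: mh.
    - move=> q Iq; rewrite lee_fin indicE; case: (boolP (q \in G)) => [|_].
        rewrite inE mulr1 => -[_]; rewrite FE/= => /not_andP[//|/negP].
        by rewrite -ltNge => /ltW.
      by rewrite mulr0 /h sumr_ge0.
  have : (K%:R / 4)%:E = (c%:E * (1 / 3)%:E)%E :> \bar R.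
    by rewrite -EFinM /c; congr (_%:E); field.
  by move=> ->; rewrite lee_pmul2l// lte_fin.
have : (mu G = mu I - mu F)%E.
  have FI : I `&` F = F by rewrite setIidr// FE => q [].
  rewrite -[in RHS]FI; apply: (@measureD _ _ _ lebesgue_measure) => //.
  by rewrite [ltLHS]muI ltry.
rewrite muI => e; move: muG; rewrite e; rewrite /mu.
case: (lebesgue_measure F) => [r| |] //=; rewrite ?leey//.
by rewrite -EFinB !lee_fin; lra.
Qed.

(** The upper limit of sets of measure at least [1/6] inside a set of finite
    measure has measure at least [1/6]. *)
Lemma frequently_unexceptional (R : realType) (B : nat -> set R) :
  (forall j, measurable (B j)) ->
  (forall j, (lebesgue_measure (B j) <= (1 / 4)%:E)%E) ->
  exists Q : set R, [/\ measurable Q, Q `<=` `[1 / 4, 3 / 4],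
    ((1 / 6)%:E <= lebesgue_measure Q)%E &
    forall q n, Q q -> exists2 K, (n < K)%N &
      \sum_(j < K) (\1_(B j) q : R) <= 3 / 4 * K%:R].
Proof.
move=> mB muB.
pose F K := [set q : R | 1 / 4 <= q <= 3 / 4 /\
                        \sum_(j < K.+1) (\1_(B j) q : R) <= 3 / 4 * K.+1%:R].
have mF K : measurable (F K).
  by have [] := measure_mostly_unexceptional (ltn0Sn K) mB muB.
have muF K : ((1 / 6)%:E <= lebesgue_measure (F K))%E.
  by have [] := measure_mostly_unexceptional (ltn0Sn K) mB muB.
pose G n := \bigcup_(K in [set K | (n <= K)%N]) F K.
have mG n : measurable (G n) by exact: bigcup_measurable.
exists (lim_sup_set F); split.
- exact: bigcapT_measurable.
- move=> q /(_ 0%N Logic.I)[K _ [hq _]]; by rewrite /= in_itv.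
- have cv : lebesgue_measure (G n) @[n --> \oo] --> lebesgue_measure (lim_sup_set F).
    apply: lim_sup_set_cvg => //.
    apply: (@le_lt_trans _ _ (lebesgue_measure (`[1 / 4, 3 / 4]%classic : set R))).
      apply: le_measure; rewrite ?inE//; [exact: mG|].
      by move=> q [K _ [hq _]]; rewrite /= in_itv.
    by rewrite lebesgue_measure_itv/=; case: ifP => _; rewrite -?EFinD ltry.
  rewrite -(cvg_lim _ cv)//; apply: lime_ge.
    by apply/cvg_ex; eexists; exact: cv.
  near=> n; apply: le_trans (muF n) _; apply: le_measure; rewrite ?inE; [exact: mF|exact: mG|].
  by move=> q Fq; exists n => /=.
- move=> q n /(_ n Logic.I)[K nK [_ ?]]; exists K.+1 => //.
Unshelve. all: by end_near. Qed.

(** * Expectations along a run *)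

Lemma integral_by_cases (R : realType) (d : measure_display)
    (Omega : measurableType d) (P : probability Omega R) (I : finType)
    (V : Omega -> I) (g : I -> Omega -> R) :
  (forall i, measurable (V @^-1` [set i])) ->
  (forall i, measurable_fun setT (g i)) ->
  (forall i w, 0 <= g i w) ->
  measurable_fun setT (fun w => g (V w) w) /\
  (\int[P]_w (g (V w) w)%:E =
   \sum_(i : I) \int[P]_(w in V @^-1` [set i]) (g i w)%:E)%E.
Proof.
move=> mV mg g0.
pose s i w : R := g i w * \1_(V @^-1` [set i]) w.
have gE w : g (V w) w = \sum_i s i w.
  rewrite (bigD1 (V w))//= big1 ?addr0 => [|i iV].
    by rewrite /s indicE mem_set// mulr1.
  by rewrite /s indicE memNset ?mulr0//= => /eqP; rewrite eq_sym (negbTE iV).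
have ms i : measurable_fun setT (s i).
  by apply: measurable_funM => //; exact: measurable_indic.
split.
  rewrite (_ : (fun w => g (V w) w) = fun w => \sum_i s i w); last exact/funext.
  exact: measurable_sum.
under eq_integral do rewrite gE -sumEFin.
rewrite ge0_integral_sum//; last 2 first.
- by move=> i; apply/measurable_EFinP; exact: ms.
- by move=> i w _; rewrite lee_fin mulr_ge0.
apply: eq_bigr => i _; rewrite [RHS]integral_mkcond epatch_indic.
by apply: eq_integral => w _; rewrite /s EFinM.
Qed.

(** Independence is given for events only.  Restricting [P] to [B] and pushing
    the result forward along the seed yields [P B] times the uniform law, which
    extends the product rule from events to integrands. *)
Lemma integral_independent_seed (R : realType) (d d2 : measure_display)
    (Omega : measurableType d) (E2 : measurableType d2)
    (P : probability Omega R) (S : nat -> {RV P >-> E2}) (U : {RV P >-> R})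
    (f : R -> R) (B : set Omega) :
  uniform_seed U -> independent_of_process U S ->
  measurable_fun setT f -> (forall u, 0 <= f u) ->
  measurable B -> events_of_process S B ->
  (\int[P]_(w in B) (f (U w))%:E =
   P B * \int[uniform_prob (@ltr01 R)]_u (f u)%:E)%E.
Proof.
move=> [_ unif] ind mf f0 mB evB.
have mfU : measurable_fun setT (fun w => (f (U w))%:E).
  by apply/measurable_EFinP; apply: measurableT_comp.
have PB : P B = (fine (P B))%:E by rewrite fineK// fin_num_measure.
have PB0 : 0 <= fine (P B) by rewrite fine_ge0.
have -> : (\int[P]_(w in B) (f (U w))%:E =
           \int[mrestr P mB]_w (f (U w))%:E)%E.
  rewrite [RHS](@ge0_negligible_integral _ _ _ _ _ (~` B))//; last 3 first.
  - exact: measurableC.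
  - by move=> w _; rewrite lee_fin.
  - by rewrite /= /mrestr setICl measure0.
  rewrite setTD setCK; apply: eq_measure_integral => A mA AB.
  by rewrite /= /mrestr setIidl.
have mU : measurable_fun setT (U : Omega -> measurableTypeR R).
  exact: (measurable_funP U).
have mf' : measurable_fun setT (EFin \o f : measurableTypeR R -> \bar R).
  by apply/measurable_EFinP; exact: mf.
have := @ge0_integral_pushforward _ _ _ _ _ _ mU (mrestr P mB) setT
  (EFin \o f) measurableT mf'; rewrite preimage_setT => <-; last first.
  by move=> u _; rewrite lee_fin.
pose M := @measure_function_pushforward__canonical__measure_function_Measure
  _ _ _ _ _ (mrestr P mB) (U : Omega -> measurableTypeR R) mU.
rewrite (@eq_measure_integral _ _ _ _
  (mscale (NngNum PB0) (uniform_prob (@ltr01 R))) M); last first.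
  move=> A mA _; rewrite /= /pushforward /mrestr /mscale/=.
  by rewrite [LHS](ind A B mA evB) -PB muleC; congr (_ * _)%E; exact: unif.
rewrite ge0_integral_mscale//=; last by move=> u _; rewrite lee_fin.
by rewrite -PB.
Qed.

Lemma state_preimage_measurable (R : realType) (d : measure_display)
    (Omega : measurableType d) (P : probability Omega R)
    (S : nat -> {RV P >-> bool}) (t : nat) (A : set bool) :
  measurable (S t @^-1` A).
Proof. by rewrite -[X in measurable X]setTI; exact: measurable_funP. Qed.

Lemma state_probability (R : realType) (d : measure_display)
    (Omega : measurableType d) (P : probability Omega R)
    (S : nat -> {RV P >-> bool}) (q : R) (t : nat) (b : bool) :
  bernoulli_iid q S -> P (S t @^-1` [set b]) = (coin q b)%:E.
Proof.
move=> [hq _]; case: b; first exact: hq.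
rewrite (_ : _ @^-1` _ = ~` (S t @^-1` [set true])).
  by rewrite probability_setC ?hq//; exact: state_preimage_measurable.
by apply/seteqP; split => w /=; case: (S t w).
Qed.

Definition history (Omega : Type) (S : nat -> Omega -> bool) (t : nat)
    (w : Omega) : t.+1.-tuple bool := [tuple S i w | i < t.+1].

Lemma in_slots (t i : nat) : (i \in [fset i in iota 0 t.+1]%fset) = (i < t.+1)%N.
Proof. by rewrite in_fset; exact: mem_iota. Qed.

Lemma history_preimage (Omega : Type) (S : nat -> Omega -> bool) (t : nat)
    (h : t.+1.-tuple bool) :
  history S t @^-1` [set h] =
  \bigcap_(i in [set` [fset i in iota 0 t.+1]%fset])
    S i @^-1` [set nth false h i].
Proof.
apply/seteqP; split => [w /= <- i|w hw].
  rewrite /= in_slots => it; rewrite /history.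
  have := tnth_mktuple (fun j : 'I_t.+1 => S j w) (Ordinal it).
  by rewrite (tnth_nth false).
apply: eq_from_tnth => i; rewrite tnth_mktuple (tnth_nth false).
by have := hw i; apply; rewrite /= in_slots.
Qed.

Lemma history_event (R : realType) (d : measure_display)
    (Omega : measurableType d) (P : probability Omega R)
    (S : nat -> {RV P >-> bool}) (t : nat) (h : t.+1.-tuple bool) :
  measurable (history S t @^-1` [set h]) /\
  events_of_process S (history S t @^-1` [set h]).
Proof.
rewrite history_preimage; split.
  apply: bigcap_measurable; first by exists 0%N; rewrite /= in_slots.
  by move=> k _; exact: state_preimage_measurable.
set G := [set B | exists t, exists2 C, measurable C & B = S t @^-1` C].
apply: (@bigcap_measurable _ (g_sigma_algebraType G)).
  by exists 0%N; rewrite /= in_slots.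
move=> k _; apply: sub_sigma_algebra; exists k; exists [set nth false h k] => //.
Qed.

Lemma history_probability (R : realType) (d : measure_display)
    (Omega : measurableType d) (P : probability Omega R)
    (S : nat -> {RV P >-> bool}) (q : R) (t : nat) (h : t.+1.-tuple bool) :
  bernoulli_iid q S ->
  P (history S t @^-1` [set h]) =
  (past_weight (coin q) h * coin q (tnth h ord_max))%:E.
Proof.
move=> hS; rewrite history_preimage (hS.2 _ (fun i => [set nth false h i]))//.
under eq_bigr do rewrite (state_probability _ _ hS).
rewrite (perm_big (iota 0 t.+1)); last first.
  apply: uniq_perm => [||i]; [exact: fset_uniq|exact: iota_uniq|].
  by rewrite in_slots mem_iota.
rewrite prodEFin; congr (_%:E).
rewrite -[iota _ _]/(index_iota 0 t.+1) big_mkord big_ord_recr/= /past_weight.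
congr (_ * _); last by rewrite (tnth_nth false).
by apply: eq_bigr => i _; rewrite (tnth_nth false).
Qed.

Lemma decision_set_unit (R : realType) (s : bool) (x : R * R) :
  decision_set s x -> 0 <= x.1 <= 1 /\ 0 <= x.2 <= 1.
Proof.
case: s => [[r /andP[r0 r1] ->]|->] /=; last by rewrite !lexx !ler01.
by split; apply/andP; split; nra.
Qed.

(** An algorithm is constrained only on seeds in [[0, 1[]; the restriction sets
    the response to zero elsewhere, which makes it bounded and measurable on the
    whole line. *)
Definition seed_response (R : realType) (Xhat : algorithm R) (c : R * R -> R)
    (t : nat) (h : t.+1.-tuple bool) : R -> R :=
  (fun u => c (Xhat t (u, h))) \_ `[0, 1[.

Definition seed_mean (R : realType) (Xhat : algorithm R) (c : R * R -> R)
    (t : nat) (h : t.+1.-tuple bool) : R :=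
  fine (\int[uniform_prob (@ltr01 R)]_u (seed_response Xhat c h u)%:E)%E.

(** Expectations of the two coordinates of a decision are computed in the same
    way; this is all that the computation uses. *)
Definition unit_coordinate (R : realType) (c : R * R -> R) : Prop :=
  measurable_fun setT c /\
  forall (s : bool) (x : R * R), decision_set s x -> 0 <= c x <= 1.

Lemma unit_coordinate_fst (R : realType) :
  unit_coordinate (fst : R * R -> R).
Proof. by split=> [|s x /decision_set_unit[]]. Qed.

Lemma unit_coordinate_snd (R : realType) :
  unit_coordinate (snd : R * R -> R).
Proof. by split=> [|s x /decision_set_unit[]]. Qed.

Lemma measurable_seed_response (R : realType) (Xhat : algorithm R)
    (c : R * R -> R) (t : nat) (h : t.+1.-tuple bool) :
  statistics_unaware Xhat -> unit_coordinate c ->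
  measurable_fun setT (seed_response Xhat c h).
Proof.
move=> hX [mc _].
apply/(measurable_restrictT (fun u => c (Xhat t (u, h)))).
  exact: measurable_itv.
apply: measurableT_comp => //.
apply: (@measurable_comp _ _ _ _ _ _
  (`[0, 1[%classic `*` setT : set (R * t.+1.-tuple bool)) (Xhat t)).
- by apply: measurableX => //; exact: measurable_itv.
- by move=> _ [u hu <-].
- by have [] := hX t.
- by apply: measurable_funTS; apply: measurable_fun_pair.
Qed.

Lemma seed_response_unit (R : realType) (Xhat : algorithm R) (c : R * R -> R)
    (t : nat) (h : t.+1.-tuple bool) (u : R) :
  statistics_unaware Xhat -> unit_coordinate c ->
  0 <= seed_response Xhat c h u <= 1.
Proof.
move=> hX [_ hc]; rewrite /seed_response patchE; case: ifPn => [|_].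
  rewrite inE => hu; have [_ /(_ u h hu)] := hX t; exact: hc.
by rewrite lexx ler01.
Qed.

Lemma integral_uniform_cst (R : realType) (r : R) :
  (\int[uniform_prob (@ltr01 R)]_u r%:E = r%:E)%E.
Proof.
rewrite integral_cst// [X in (_ * X)%E](_ : _ = 1%E) ?mule1//.
exact: probability_setT.
Qed.

Lemma seed_meanE (R : realType) (Xhat : algorithm R) (c : R * R -> R)
    (t : nat) (h : t.+1.-tuple bool) :
  statistics_unaware Xhat -> unit_coordinate c ->
  (\int[uniform_prob (@ltr01 R)]_u (seed_response Xhat c h u)%:E)%E =
    (seed_mean Xhat c h)%:E /\ 0 <= seed_mean Xhat c h <= 1.
Proof.
move=> hX hc.
set I := (\int[_]_u _)%E.
have m : measurable_fun setT
    (fun u : measurableTypeR R => (seed_response Xhat c h u)%:E).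
  by apply/measurable_EFinP; exact: measurable_seed_response.
have I0 : (0 <= I)%E.
  apply: integral_ge0 => u _; rewrite lee_fin.
  by have /andP[] := seed_response_unit h u hX hc.
have I1 : (I <= 1)%E.
  apply: (@le_trans _ _ (\int[uniform_prob (@ltr01 R)]_u 1)%E).
    apply: ge0_le_integral => //.
    - move=> u _; rewrite lee_fin.
      by have /andP[] := seed_response_unit h u hX hc.
    - move=> u _; rewrite lee_fin.
      by have /andP[] := seed_response_unit h u hX hc.
  by rewrite integral_uniform_cst.
have IE : I = (seed_mean Xhat c h)%:E.
  by rewrite fineK// ge0_fin_numE// (le_lt_trans I1)// ltry.
by split=> //; rewrite -!lee_fin -IE I0 I1.
Qed.

Lemma seed_mean_idle (R : realType) (Xhat : algorithm R) (t : nat)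
    (h : t.+1.-tuple bool) : statistics_unaware Xhat ->
  tnth h ord_max = false -> seed_mean Xhat snd h = 0.
Proof.
move=> hX hf; rewrite /seed_mean integral0_eq// => u _.
rewrite /seed_response patchE; case: ifPn => //.
by rewrite inE => hu; have [_ /(_ u h hu)] := hX t; rewrite hf /= => ->.
Qed.

(** Averaging over the seed is dominated by a constant rate: the decision set is
    the graph of a concave function.  Jensen's inequality is obtained by
    integrating [1 - a ^+ 2 <= 1 + m ^+ 2 - 2 * m * a], where [m] is the mean
    of [a]. *)
Lemma seed_mean_active (R : realType) (Xhat : algorithm R) (t : nat)
    (h : t.+1.-tuple bool) : statistics_unaware Xhat ->
  tnth h ord_max = true ->
  seed_mean Xhat snd h <= 1 - seed_mean Xhat fst h ^+ 2.
Proof.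
move=> hX ht.
have [e1 /andP[m0 m1]] := seed_meanE h hX (unit_coordinate_fst R).
have [e2 _] := seed_meanE h hX (unit_coordinate_snd R).
set m := seed_mean Xhat fst h in e1 m0 m1 *.
set p := seed_mean Xhat snd h in e2 *.
pose a := seed_response Xhat fst h; pose b := seed_response Xhat snd h.
have u1 u := seed_response_unit h u hX (unit_coordinate_fst R).
have u2 u := seed_response_unit h u hX (unit_coordinate_snd R).
have ma : measurable_fun setT (fun u : measurableTypeR R => (a u)%:E).
  apply/measurable_EFinP; apply: measurable_seed_response => //.
  exact: unit_coordinate_fst.
have mb : measurable_fun setT (fun u : measurableTypeR R => (b u)%:E).
  apply/measurable_EFinP; apply: measurable_seed_response => //.
  exact: unit_coordinate_snd.
have E : (\int[uniform_prob (@ltr01 R)]_u ((b u)%:E + (2 * m)%:E * (a u)%:E) =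
    (p + 2 * m * m)%:E)%E.
  have k0 : (0 <= (2 * m)%:E)%E by rewrite lee_fin mulr_ge0.
  rewrite ge0_integralD//; last 3 first.
  - by move=> u _; rewrite lee_fin; have /andP[] := u2 u.
  - by move=> u _; rewrite mule_ge0// lee_fin; have /andP[] := u1 u.
  - exact: measurable_funeM.
  rewrite e2 ge0_integralZl ?e1//.
  by move=> u _; rewrite lee_fin; have /andP[] := u1 u.
have : ((p + 2 * m * m)%:E <= (1 + m ^+ 2)%:E)%E.
  rewrite -E.
  apply: (@le_trans _ _ (\int[uniform_prob (@ltr01 R)]_u (1 + m ^+ 2)%:E)%E).
    apply: ge0_le_integral => //.
    - move=> u _; rewrite -EFinM -EFinD lee_fin.
      have /andP[? _] := u1 u; have /andP[? _] := u2 u.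
      by rewrite addr_ge0// !mulr_ge0.
    - by apply: emeasurable_funD => //; exact: measurable_funeM.
    - move=> u _; rewrite -EFinM -EFinD lee_fin /a /b /seed_response !patchE.
      case: ifPn => [|_].
        rewrite inE => hu; have [_ /(_ u h hu)] := hX t.
        rewrite ht /= => -[r _ ->] /=.
        by have := sqr_ge0 (r - m); lra.
      by rewrite -[point]/(0 : R); have := sqr_ge0 m; lra.
  by rewrite integral_uniform_cst.
rewrite lee_fin; lra.
Qed.

Definition slot_mean (R : realType) (Xhat : algorithm R) (c : R * R -> R)
    (q : R) (t : nat) : R :=
  \sum_(h : t.+1.-tuple bool)
    past_weight (coin q) h * coin q (tnth h ord_max) * seed_mean Xhat c h.

(** Conditionally on the history, the seed is still uniform, so the expected
    decision is the average of the seed means over histories.  The right-hand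
    side does not mention the probability space: this is why the lower bounds
    depend on the algorithm and on [q] alone. *)
Lemma run_slot_mean (R : realType) (d : measure_display)
    (Omega : measurableType d) (P : probability Omega R)
    (S : nat -> {RV P >-> bool}) (U : {RV P >-> R}) (q : R)
    (Xhat : algorithm R) (c : R * R -> R) (t : nat) :
  statistics_unaware Xhat -> unit_coordinate c ->
  bernoulli_iid q S -> uniform_seed U -> independent_of_process U S ->
  [/\ measurable_fun setT (fun w => c (run Xhat U S t w)),
      forall w, 0 <= c (run Xhat U S t w) &
      (\int[P]_w (c (run Xhat U S t w))%:E = (slot_mean Xhat c q t)%:E)%E].
Proof.
move=> hX hc hS hU hUS.
pose g (h : t.+1.-tuple bool) (w : Omega) := seed_response Xhat c h (U w).
have gE w : c (run Xhat U S t w) = g (history S t w) w.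
  by rewrite /g /seed_response patchE ifT// inE; exact: hU.1.
have g0 h w : 0 <= g h w by have /andP[] := seed_response_unit h (U w) hX hc.
have mg h : measurable_fun setT (g h).
  by apply: measurableT_comp => //; exact: measurable_seed_response.
have mV h : measurable (history S t @^-1` [set h]) by have [] := history_event S h.
have [mG IG] := integral_by_cases P mV mg g0.
rewrite (_ : (fun w => c _) = (fun w => g (history S t w) w)); last exact/funext.
split=> [//|w|]; first by rewrite gE.
under eq_integral do rewrite gE.
rewrite IG /slot_mean -sumEFin; apply: eq_bigr => h _.
rewrite (integral_independent_seed hU hUS).
- by rewrite (history_probability h hS) (seed_meanE h hX hc).1.
- exact: measurable_seed_response.
- by move=> u; have /andP[] := seed_response_unit h u hX hc.
- exact: mV.
- by have [] := history_event S h.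
Qed.

Lemma expectation_time_average (R : realType) (d : measure_display)
    (Omega : measurableType d) (P : probability Omega R)
    (Y : nat -> Omega -> R) (y : nat -> R) (T : nat) :
  (forall t, [/\ measurable_fun setT (Y t), forall w, 0 <= Y t w &
    (\int[P]_w (Y t w)%:E = (y t)%:E)%E]) ->
  ('E_P[time_average Y T])%E = (T%:R^-1 * \sum_(t < T) y t)%:E.
Proof.
move=> hY; rewrite unlock /time_average.
have mY t : measurable_fun setT (fun w => (Y t w)%:E).
  by apply/measurable_EFinP; have [] := hY t.
have Y0 t w : 0 <= Y t w by have [_ ->] := hY t.
under eq_integral do rewrite EFinM -sumEFin.
rewrite ge0_integralZl//; last 2 first.
- by apply: emeasurable_sum => t.
- by move=> w _; apply: sume_ge0 => t _; rewrite lee_fin.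
rewrite ge0_integral_sum//; last by move=> t w _; rewrite lee_fin.
rewrite EFinM -sumEFin; congr (_ * _)%E.
by apply: eq_bigr => t _; have [_ _ ->] := hY t.
Qed.

Lemma slot_mean_ge0 (R : realType) (Xhat : algorithm R) (c : R * R -> R)
    (q : R) (t : nat) : statistics_unaware Xhat -> unit_coordinate c ->
  0 <= q <= 1 -> 0 <= slot_mean Xhat c q t.
Proof.
move=> hX hc q01; apply: sumr_ge0 => h _.
have [_ /andP[m0 _]] := seed_meanE h hX hc.
rewrite !mulr_ge0 ?past_weight_coin_ge0// /coin.
by move: q01 => /andP[? ?]; case: ifP; lra.
Qed.

(** * Regret as an estimation error *)

(** In state 1, [2 * r * m + (1 - m ^+ 2) = 1 + r ^+ 2 - (m - r) ^+ 2]: in the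
    direction of the gradient at the optimum, a slot loses the squared
    distance of the mean rate [m] to [r]. *)
Lemma slot_mean_bound (R : realType) (Xhat : algorithm R) (q r : R) (t : nat) :
  statistics_unaware Xhat -> 0 <= q <= 1 -> 0 <= r ->
  2 * r * slot_mean Xhat fst q t + slot_mean Xhat snd q t <=
  2 * r * (1 - q) + q * (1 + r ^+ 2) -
  q * estimation_error (@seed_mean R Xhat fst t) r q.
Proof.
move=> hX q01 r0; have /andP[q0 q1] := q01.
have one b : \sum_(h : t.+1.-tuple bool | tnth h ord_max == b)
    past_weight (coin q) h = 1.
  by rewrite sum_past_weight /coin addrC subrK expr1n.
have -> : 2 * r * slot_mean Xhat fst q t + slot_mean Xhat snd q t =
    \sum_(h : t.+1.-tuple bool) past_weight (coin q) h *
      coin q (tnth h ord_max) * (2 * r * seed_mean Xhat fst h +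
                                 seed_mean Xhat snd h).
  rewrite /slot_mean mulr_sumr -big_split/=; apply: eq_bigr => h _; ring.
rewrite (bigID (fun h : t.+1.-tuple bool => tnth h ord_max == true))/=.
have active : \sum_(h : t.+1.-tuple bool | tnth h ord_max == true)
    past_weight (coin q) h * coin q (tnth h ord_max) *
      (2 * r * seed_mean Xhat fst h + seed_mean Xhat snd h) <=
    q * (1 + r ^+ 2) - q * estimation_error (@seed_mean R Xhat fst t) r q.
  have -> : q * (1 + r ^+ 2) = \sum_(h : t.+1.-tuple bool |
      tnth h ord_max == true) q * (1 + r ^+ 2) * past_weight (coin q) h.
    by rewrite -mulr_sumr one mulr1.
  rewrite /estimation_error mulr_sumr -sumrB.
  apply: ler_sum => h /eqP ht; rewrite ht (_ : coin q true = q)//.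
  have w0 := past_weight_coin_ge0 h q01.
  have := seed_mean_active hX ht.
  set m := seed_mean Xhat fst h; set p := seed_mean Xhat snd h => mp.
  set w := past_weight _ h in w0 *.
  have -> : q * (1 + r ^+ 2) * w - q * (w * (m - r) ^+ 2) =
    w * q * (2 * r * m + (1 - m ^+ 2)) by ring.
  by apply: ler_wpM2l; [exact: mulr_ge0|lra].
have idle : \sum_(h : t.+1.-tuple bool | tnth h ord_max != true)
    past_weight (coin q) h * coin q (tnth h ord_max) *
      (2 * r * seed_mean Xhat fst h + seed_mean Xhat snd h) <=
    2 * r * (1 - q).
  have -> : 2 * r * (1 - q) = \sum_(h : t.+1.-tuple bool |
      tnth h ord_max == false) 2 * r * (1 - q) * past_weight (coin q) h.
    by rewrite -mulr_sumr one mulr1.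
  rewrite (eq_bigl (fun h : t.+1.-tuple bool => tnth h ord_max == false));
    last by move=> h; case: (tnth h ord_max).
  apply: ler_sum => h /eqP hf; rewrite hf (_ : coin q false = 1 - q)//.
  have w0 := past_weight_coin_ge0 h q01.
  have [_ /andP[m0 m1]] := seed_meanE h hX (unit_coordinate_fst R).
  rewrite seed_mean_idle// addr0 [leRHS]mulrC mulrCA !mulrA -[leLHS]mulrA.
  set w := past_weight _ _ in w0 *; set m := seed_mean _ _ _ in m0 m1 *.
  have ? : 0 <= w * (1 - q) * (2 * r) by rewrite !mulr_ge0//; lra.
  nra.
lra.
Qed.

Definition stationary_value (R : realType) (q : R) : R :=
  phi (1 - q + q * optimal_rate q) (q * (1 - optimal_rate q ^+ 2)).

Lemma ln_tangent (R : realType) (x y : R) : 0 <= x -> 0 <= y ->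
  ln (1 + x) <= ln (1 + y) + (x - y) / (1 + y).
Proof.
move=> x0 y0; have y1 : 0 < 1 + y by lra.
have e : 1 + (x - y) / (1 + y) = (1 + x) / (1 + y).
  by field; rewrite gt_eqF.
have := @le_ln1Dx R ((x - y) / (1 + y)).
rewrite e ln_div ?posrE//; last lra.
have : -1 < (x - y) / (1 + y) by rewrite ltr_pdivlMr//; lra.
by move=> -> /(_ isT); lra.
Qed.

(** The tangent inequality of [ln] at the optimal averages, added up over the
    slots with [slot_mean_bound].  The factor [1 / 8] bounds
    [q / (1 + y2)] from below, as [q >= 1 / 4] and [y2 <= 1]. *)
Lemma utility_gap (R : realType) (d : measure_display)
    (Omega : measurableType d) (P : probability Omega R)
    (S : nat -> {RV P >-> bool}) (U : {RV P >-> R}) (q : R)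
    (Xhat : algorithm R) (T : nat) :
  statistics_unaware Xhat -> 1 / 4 <= q <= 3 / 4 ->
  bernoulli_iid q S -> uniform_seed U -> independent_of_process U S ->
  (0 < T)%N ->
  utility P (run Xhat U S) T <= stationary_value q - 1 / 8 *
    (T%:R^-1 * \sum_(t < T)
      estimation_error (@seed_mean R Xhat fst t) (optimal_rate q) q).
Proof.
move=> hX hq hS hU hUS T0.
have /andP[q1 q2] := hq; have q01 : 0 <= q <= 1 by apply/andP; split; lra.
have mean c (hc : unit_coordinate c) t := run_slot_mean t hX hc hS hU hUS.
rewrite /utility.
rewrite (expectation_time_average T (mean _ (unit_coordinate_fst R)))/=.
rewrite (expectation_time_average T (mean _ (unit_coordinate_snd R)))/=.
set x1 := _ * \sum_(_ < _) slot_mean _ fst _ _.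
set x2 := _ * \sum_(_ < _) slot_mean _ snd _ _.
set err := _ * \sum_(_ < _) estimation_error _ _ _.
have /andP[r1 r2] := optimal_rate_bounds hq.
have re := optimal_rate_eq hq.
rewrite /stationary_value; set r := optimal_rate q in r1 r2 re err *.
have Tp : 0 < T%:R :> R by rewrite ltr0n.
have x10 : 0 <= x1.
  rewrite mulr_ge0 ?invr_ge0// sumr_ge0// => t _.
  by apply: slot_mean_ge0 => //; exact: unit_coordinate_fst.
have x20 : 0 <= x2.
  rewrite mulr_ge0 ?invr_ge0// sumr_ge0// => t _.
  by apply: slot_mean_ge0 => //; exact: unit_coordinate_snd.
have err0 : 0 <= err.
  rewrite mulr_ge0 ?invr_ge0// sumr_ge0// => t _.
  exact: estimation_error_ge0.
have lin : 2 * r * x1 + x2 <=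
    2 * r * (1 - q) + q * (1 + r ^+ 2) - q * err.
  have r0 : 0 <= r by lra.
  have := ler_sum (index_enum 'I_T) (fun t _ => slot_mean_bound t hX q01 r0)
    (P := xpredT).
  rewrite big_split/= sumrB -!mulr_sumr sumr_const card_ord.
  set c := 2 * r * (1 - q) + q * (1 + r ^+ 2).
  rewrite -[c *+ T]mulr_natl => h.
  have Ti : 0 <= T%:R^-1 :> R by rewrite invr_ge0.
  have := ler_wpM2l Ti h.
  rewrite mulrBr mulKf ?gt_eqF// mulrDr /x1 /x2 /err; lra.
set y1 := 1 - q + q * r; set y2 := q * (1 - r ^+ 2).
have y10 : 0 <= y1 by rewrite /y1; nra.
have y20 : 0 <= y2 by rewrite /y2; nra.
have y21 : y2 <= 1 by rewrite /y2; nra.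
(* First-order optimality: the two partial derivatives of [phi] are in the
   ratio [2 * r] to [1]. *)
have grad : (1 + y1)^-1 = 2 * r / (1 + y2).
  have h1 : 1 + y2 = 2 * r * (1 + y1) by rewrite /y1 /y2; lra.
  rewrite h1; field.
  by rewrite gt_eqF; [rewrite gt_eqF//; lra|lra].
have := ln_tangent x10 y10; have := ln_tangent x20 y20.
rewrite grad /phi => t2 t1.
have Eb : (x1 - y1) * (2 * r / (1 + y2)) + (x2 - y2) / (1 + y2) =
  (2 * r * x1 + x2 - (2 * r * y1 + y2)) / (1 + y2) by ring.
have yE : 2 * r * y1 + y2 = 2 * r * (1 - q) + q * (1 + r ^+ 2).
  by rewrite /y1 /y2; ring.
have fin : (2 * r * x1 + x2 - (2 * r * y1 + y2)) / (1 + y2) <= - (1 / 8 * err).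
  rewrite ler_pdivrMr; last lra.
  apply: (@le_trans _ _ (- (q * err))); first lra.
  by nra.
lra.
Qed.

(** Any space that carries the states also carries the algorithm using the
    optimal constant rate; its averages do not depend on [T]. *)
Lemma stationary_value_achievable (R : realType) (d : measure_display)
    (Omega : measurableType d) (P : probability Omega R)
    (S : nat -> {RV P >-> bool}) (q : R) :
  1 / 4 <= q <= 3 / 4 -> bernoulli_iid q S ->
  ((stationary_value q)%:E <= phi_star q)%E.
Proof.
move=> hq hS; have /andP[r1 r2] := optimal_rate_bounds hq.
set r := optimal_rate q in r1 r2.
pose x (b : bool) : R * R := if b then (r, 1 - r ^+ 2) else (1, 0).
have mx t : measurable_fun setT (fun w => x (S t w)).
  exact: measurable_fun_ifT.
pose X t : {RV P >-> (R * R)%type} :=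
  HB.pack (fun w => x (S t w)) (isMeasurableFun.Build _ _ _ _ _ (mx t)).
have slot (c : R * R -> R) (t : nat) : measurable_fun setT c -> (forall b, 0 <= c (x b)) ->
    [/\ measurable_fun setT (fun w => c (X t w)),
      forall w, 0 <= c (X t w) &
      (\int[P]_w (c (X t w))%:E =
       (q * c (x true) + (1 - q) * c (x false))%:E)%E].
  move=> mc c0.
  have [m E] := @integral_by_cases R d Omega P bool (S t)
    (fun b => cst (c (x b))) (fun b => state_preimage_measurable S t [set b])
    (fun b => measurable_cst _) (fun b _ => c0 b).
  split=> [//|w|]; first exact: c0.
  have I b : (\int[P]_(w in S t @^-1` [set b]) (c (x b))%:E =
              (c (x b) * coin q b)%:E)%E.
    rewrite [LHS](integral_cst P (state_preimage_measurable S t [set b])) EFinM.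
    by congr (_ * _)%E; exact: state_probability.
  by rewrite [LHS]E big_bool/= !I -EFinD /coin; congr (_%:E); ring.
have mean1 t := slot fst t measurable_fst ltac:(case => /=; lra).
have mean2 t := slot snd t measurable_snd ltac:(case => /=; nra).
apply: ereal_sup_ubound; exists d, Omega, P, S, X; split=> //.
  move=> t w; rewrite /X /= /x; case: (S t w) => //=.
  by exists r => //; apply/andP; split; lra.
have cv : (utility P X T)%:E @[T --> \oo] --> (stationary_value q)%:E.
  apply: cvg_near_cst; exists 1%N => // T /= T0.
  rewrite /utility (expectation_time_average T mean1)/=.
  rewrite (expectation_time_average T mean2)/=.
  have avg (y : R) : T%:R^-1 * \sum_(t < T) y = y.
    by rewrite sumr_const card_ord -[y *+ T]mulr_natl mulKf// pnatr_eq0 -lt0n.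
  rewrite !avg /stationary_value -/r.
  by congr ((phi _ _)%:E); ring.
by rewrite (cvg_limn_einf_sup cv).1.
Qed.

(** * Logarithmic growth *)

Lemma sum_block_error_le (R : realType) (A : forall t, t.+1.-tuple bool -> R)
    (K T : nat) (q : R) : 0 <= q <= 1 -> (4 ^ K <= T)%N ->
  \sum_(j < K) block_error A j q <=
  \sum_(t < T) estimation_error (A t) (optimal_rate q) q.
Proof.
move=> q01.
have e0 m n :
    0 <= \sum_(m <= t < n) estimation_error (A t) (optimal_rate q) q.
  by apply: sumr_ge0 => t _; exact: estimation_error_ge0.
rewrite -(big_mkord xpredT (fun t => estimation_error (A t) _ _)).
elim: K T => [|K IH] T hT; first by rewrite big_ord0.
have hK : (4 ^ K <= 4 ^ K.+1)%N by rewrite leq_exp2l.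
rewrite big_ord_recr/= (big_cat_nat (leq0n _) (leq_trans hK hT))/=.
rewrite (big_cat_nat hK hT)/=.
apply: lerD; first exact: IH.
by rewrite lerDl.
Qed.

Lemma sum_even_le (R : realType) (f : nat -> R) (m K : nat) :
  (forall j, 0 <= f j) -> (m.*2 <= K)%N ->
  \sum_(k < m) f k.*2 <= \sum_(j < K) f j.
Proof.
move=> f0 mK; apply: (@le_trans _ _ (\sum_(j < m.*2) f j)).
  elim: m {mK} => [|m IH]; first by rewrite !big_ord0.
  by rewrite doubleS !big_ord_recr/= ler_wpDr// lerD.
rewrite -(big_mkord xpredT f) -(big_mkord xpredT f (n := K)).
rewrite (big_cat_nat (leq0n _) mK)/= lerDl.
by apply: sumr_ge0 => j _.
Qed.

Lemma ln4_le2 (R : realType) : ln 4 <= 2 :> R.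
Proof.
have -> : 4 = (1 + 1) ^+ 2 :> R by ring.
rewrite lnXn; last lra.
by have := @le_ln1Dx R 1; rewrite mulr2n => /(_ ltac:(lra)); lra.
Qed.

Lemma ln_expn4_le (R : realType) (K : nat) : ln (4 ^ K)%:R <= 2 * K%:R :> R.
Proof.
rewrite natrX lnXn// -[leLHS]mulr_natr; apply: ler_wpM2r => //; exact: ln4_le2.
Qed.

Lemma beta_sqr_gt0 (R : realType) : 0 < beta R ^+ 2.
Proof.
rewrite /beta.
have z0 := sqrtr_ge0 (7 : R).
have z2 : Num.sqrt (7 : R) ^+ 2 = 7 by rewrite sqr_sqrtr.
set z := Num.sqrt _ in z0 z2 *.
have ? : z <= 27 / 10 by nra.
by apply: exprn_gt0; lra.
Qed.

Lemma limn_esup_ge (R : realType) (u : (\bar R)^nat) (l : \bar R) :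
  (forall n, exists2 k, (n <= k)%N & (l <= u k)%E) -> (l <= limn_esup u)%E.
Proof.
move=> h; rewrite limn_esup_lim; apply: lime_ge; first exact: is_cvg_esups.
near=> n; have [k nk] := h n; move/le_trans; apply.
by apply: ereal_sup_ubound; exists k.
Unshelve. all: by end_near. Qed.

(** A horizon [T] contains the blocks below [trunc_log 4 T], about half of which
    have an even index. *)
Lemma exists_log_error_everywhere (R : realType)
    (A : forall t, t.+1.-tuple bool -> R) :
  exists2 q : R, 1 / 4 <= q <= 3 / 4 &
    forall T, (16 <= T)%N -> beta R ^+ 2 / 256 * ln T%:R <=
      \sum_(t < T) estimation_error (A t) (optimal_rate q) q.
Proof.
have [q hq good] := pairwise_good_point (block_error_pairwise_good A).
have q01 : 0 <= q <= 1 by move: hq => /andP[? ?]; apply/andP; split; lra.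
exists q => // T T16.
have T0 : (0 < T)%N by exact: leq_trans T16.
have /andP[KT TK] := trunc_log_bounds (isT : (1 < 4)%N) T0.
set K := trunc_log 4 T in KT TK.
have K2 : (2 <= K)%N by apply: trunc_log_max.
apply: le_trans (sum_block_error_le A q01 KT).
have b0 j : 0 <= block_error A j q.
  by apply: sumr_ge0 => t _; exact: estimation_error_ge0.
have hK : (K./2.*2 <= K)%N by rewrite -{2}(odd_double_half K) leq_addl.
apply: le_trans (sum_even_le b0 hK).
apply: (@le_trans _ _ (\sum_(k < K./2) beta R ^+ 2 / 32)); last first.
  by apply: ler_sum => k _; exact: good.
rewrite sumr_const card_ord -[leRHS]mulr_natr.
have lnT : ln T%:R <= 2 * K.+1%:R :> R.
  apply: le_trans (ln_expn4_le R K.+1).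
  by rewrite ler_ln ?posrE ?ltr0n ?expn_gt0// ler_nat ltnW.
have Kb : K.+1%:R <= 4 * (K./2)%:R :> R.
  rewrite -(natrM _ 4) ler_nat.
  lia.
have := beta_sqr_gt0 R; set b := beta R ^+ 2 => bp.
apply: (@le_trans _ _ (b / 256 * (8 * (K./2)%:R))); last lra.
by apply: ler_wpM2l; [rewrite divr_ge0// ltW|lra].
Qed.

Theorem theorem3 (R : realType) (Xhat : algorithm R)
    (hX : statistics_unaware Xhat) :
  (exists (q : R) (g : nat -> R),
     [/\ 1 / 4 <= q <= 3 / 4, Omega_log_over_T g &
       forall (d : measure_display) (Omega : measurableType d)
              (P : probability Omega R) (S : nat -> {RV P >-> bool})
              (U : {RV P >-> R}),
         bernoulli_iid q S -> uniform_seed U -> independent_of_process U S ->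
         forall T : nat, (0 < T)%N ->
           ((utility P (run Xhat U S) T)%:E <= phi_star q - (g T)%:E)%E]) /\
  (exists Q : set R,
     [/\ measurable Q, Q `<=` `[1 / 4, 3 / 4],
         ((1 / 6)%:E <= lebesgue_measure Q)%E &
       forall q : R, Q q ->
       forall (d : measure_display) (Omega : measurableType d)
              (P : probability Omega R) (S : nat -> {RV P >-> bool})
              (U : {RV P >-> R}),
         bernoulli_iid q S -> uniform_seed U -> independent_of_process U S ->
         ((3 * beta R ^+ 2 / 2 ^+ 13)%:E <=
          limn_esup (fun T : nat =>
            (T%:R%:E * phi_star q - (T%:R * utility P (run Xhat U S) T)%:E) *
            ((ln T%:R)^-1)%:E))%E]).
Proof.
pose A t : t.+1.-tuple bool -> R := seed_mean Xhat fst (t := t).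
have bp := beta_sqr_gt0 R.
split.
  have [q hq good] := exists_log_error_everywhere A.
  pose err T := \sum_(t < T) estimation_error (A t) (optimal_rate q) q.
  exists q, (fun T => 1 / 8 * (T%:R^-1 * err T)); split; first exact: hq.
    exists (beta R ^+ 2 / 256 / 8), 16%N; split; first lra.
    move=> T T0 /good; rewrite -/(err T) => h.
    have Ti : 0 <= T%:R^-1 :> R by rewrite invr_ge0.
    have := ler_wpM2l Ti h.
    move: (beta R ^+ 2) (err T) (ln _) (T%:R^-1) => b e l i; lra.
  move=> d Omega P S U hS hU hUS T T0.
  apply: (@le_trans _ _ (stationary_value q - 1 / 8 * (T%:R^-1 * err T))%:E).
    by rewrite lee_fin; exact: utility_gap.
  by rewrite EFinB; apply: leeB => //; exact: (stationary_value_achievable hq hS).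
have pg := block_error_pairwise_good A.
pose B j := projT1 (cid (pairwise_good_exceptional_set j pg)).
have BP j : [/\ measurable (B j), (lebesgue_measure (B j) <= (1 / 4)%:E)%E &
    forall q, 1 / 4 <= q <= 3 / 4 -> ~ B j q ->
      beta R ^+ 2 / 32 <= block_error A j q].
  exact: projT2 (cid (pairwise_good_exceptional_set j pg)).
have mB j : measurable (B j) by have [] := BP j.
have muB j : (lebesgue_measure (B j) <= (1 / 4)%:E)%E by have [] := BP j.
have [Q [mQ subQ muQ freq]] := frequently_unexceptional mB muB.
exists Q; split=> // q Qq d Omega P S U hS hU hUS.
have hq : 1 / 4 <= q <= 3 / 4 by have := subQ _ Qq; rewrite /= in_itv.
have q01 : 0 <= q <= 1 by move: hq => /andP[? ?]; apply/andP; split; lra.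
apply: limn_esup_ge => n; have [K nK few] := freq q n Qq.
have K0 : (0 < K)%N by exact: leq_ltn_trans nK.
(* The horizon ends with block [K.-1], so [ln T <= 2 * K] while at least [K / 4]
   of the blocks contribute [beta ^+ 2 / 32] each. *)
exists (4 ^ K)%N; first by rewrite (leq_trans (ltnW nK))// ltnW// ltn_expl.
set T := (4 ^ K)%N; have T0 : (0 < T)%N by rewrite expn_gt0.
have Tp : 0 < T%:R :> R by rewrite ltr0n.
set err := \sum_(t < T) estimation_error (A t) (optimal_rate q) q.
have errK : beta R ^+ 2 / 128 * K%:R <= err.
  apply: le_trans (sum_block_error_le A q01 (leqnn _)).
  apply: (@le_trans _ _
    (\sum_(j < K) beta R ^+ 2 / 32 * (1 - (\1_(B j) q : R)))).
    rewrite -mulr_sumr sumrB sumr_const card_ord.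
    by have := few; rewrite -[1 *+ K]/(K%:R); nra.
  apply: ler_sum => j _; rewrite indicE; case: (boolP (q \in B j)) => qB.
    rewrite subrr mulr0 sumr_ge0// => t _; exact: estimation_error_ge0.
  rewrite subr0 mulr1; have [_ _] := BP j; apply => //.
  by move: qB; rewrite notin_setE.
have gap := utility_gap hX hq hS hU hUS T0; rewrite -/err in gap.
set u := utility _ _ _ in gap *.
have lnT0 : 0 < ln T%:R :> R.
  by rewrite ln_gt0// ltr1n /T -{1}(expn0 4) ltn_exp2l.
have lnT2 := ln_expn4_le R K; rewrite -/T in lnT2.
apply: (@le_trans _ _ (((T%:R * stationary_value q - T%:R * u) *
                        (ln T%:R)^-1)%:E)).
  rewrite lee_fin ler_pdivlMr//.
  have h : err / 8 <= T%:R * stationary_value q - T%:R * u.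
    rewrite -mulrBr -ler_pdivrMl// mulrC.
    by have := gap; lra.
  have : beta R ^+ 2 * ln T%:R <= beta R ^+ 2 * (2 * K%:R).
    by apply: ler_wpM2l => //; exact: ltW.
  have : 0 <= beta R ^+ 2 * ln T%:R by rewrite mulr_ge0// ltW.
  lra.
rewrite EFinM; apply: lee_wpmul2r; first by rewrite lee_fin invr_ge0 ltW.
rewrite EFinB; apply: leeB => //; rewrite EFinM; apply: lee_wpmul2l.
  by rewrite lee_fin ltW.
exact: (stationary_value_achievable hq hS).
Qed.
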